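(* Let $G$ be a connected trivially perfect graph having a true twin partition $\mathcal{W}=\{W_1,\dots,W_k\}$ such that $|W_i|\ge 6$ for each $i=1,\dots,k$. Then the distance matrix $D(G)$ is invertible, i.e., its nullity is $0$.
   Context: All graphs are finite and simple. A graph is trivially perfect if it contains no induced subgraph isomorphic to $P_4$ (path on 4 vertices) or $C_4$ (cycle on 4 vertices). Two vertices $u,v$ are true twins if $N[u]=N[v]$, where $N[v]$ is the closed neighborhood of $v$. A true twin partition of $G$ is a partition of $V(G)$ into sets each consisting of pairwise true twins. The distance matrix $D(G)$ of a connected graph has $(i,j)$-entry the shortest-path distance between the $i$-th and $j$-th vertices. *)

(* Defs.v *)
(* World: MathComp. *)
From HB Require Import structures.
From mathcomp Require Import all_boot all_order all_algebra.

Set Implicit Arguments.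
Unset Strict Implicit.
Unset Printing Implicit Defensive.

Import GRing.Theory Num.Theory.
Local Open Scope ring_scope.

(* A finite simple graph is a symmetric irreflexive relation on a finType. *)
Definition simple_graph (T : finType) (e : rel T) : Prop :=
  symmetric e /\ irreflexive e.

Definition connected_graph (T : finType) (e : rel T) : Prop :=
  forall x y : T, connect e x y.

Definition has_induced (H : finType) (h : rel H) (T : finType) (e : rel T) :
    Prop :=
  exists f : H -> T, injective f /\ forall x y, e (f x) (f y) = h x y.

Definition P4 : rel 'I_4 :=
  fun i j => (i.+1 == j :> nat)%N || (j.+1 == i :> nat)%N.

Definition C4 : rel 'I_4 :=
  fun i j => (i.+1 %% 4 == j :> nat)%N || (j.+1 %% 4 == i :> nat)%N.

Definition trivially_perfect (T : finType) (e : rel T) : Prop :=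
  ~ has_induced P4 e /\ ~ has_induced C4 e.

Definition closed_nbhd (T : finType) (e : rel T) (v : T) : {set T} :=
  [set w | (w == v) || e v w].

Definition true_twins (T : finType) (e : rel T) (u v : T) : Prop :=
  closed_nbhd e u = closed_nbhd e v.

Definition true_twin_partition (T : finType) (e : rel T) (W : {set {set T}}) :
    Prop :=
  partition W [set: T] /\
  forall A : {set T}, A \in W -> {in A &, forall u v, true_twins e u v}.

Definition has_path (T : finType) (e : rel T) (x y : T) (n : nat) : bool :=
  [exists p : n.-tuple T, [&& path e x p, uniq (x :: p) & last x p == y]].

(* A path has fewer than #|T| edges, so searching lengths below #|T| finds the
   least one; the value is #|T| when y is not reachable from x. *)
Definition gdist (T : finType) (e : rel T) (x y : T) : nat :=
  find (has_path e x y) (iota 0 #|T|).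

Definition distance_matrix (R : nzRingType) (T : finType) (e : rel T) :
    'M[R]_#|T| :=
  \matrix_(i, j) (gdist e (enum_val i) (enum_val j))%:R.

(* kermx is the left kernel, hence the transpose. *)
Definition nullity (F : fieldType) (m n : nat) (A : 'M[F]_(m, n)) : nat :=
  \rank (kermx A^T).

(* Main.v *)
(* A universal vertex makes all distances at most 2, so a kernel vector [x] of
   the distance matrix satisfies [x v + \sum_(w in N[v]) x w = 2 * s] for every
   [v], where [s] is the sum of all entries.  On a union [B] of twin classes,
   the equations [x v + \sum_(w in N[v] :&: B) x w = c] force
   [\sum_(v in B) x v = F * c] with [F] depending on [B] only: [F] is additive
   over disconnected pieces, and adding [w] universal vertices replaces
   [1/(1 - F)] by [w + 1/(1 - F)].  For [w >= 6] this keeps [F >= 3/4], so that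
   [s = F * (2 * s)] yields [s = 0], and then [x = 0]. *)
Require Import Defs.
From HB Require Import structures.
From mathcomp Require Import all_boot all_order all_algebra.
From mathcomp Require Import lra ring.

Set Implicit Arguments.
Unset Strict Implicit.
Unset Printing Implicit Defensive.

Import GRing.Theory Num.Theory.
Local Open Scope ring_scope.

Lemma in_closed_nbhd (T : finType) (e : rel T) (v w : T) :
  (w \in closed_nbhd e v) = (w == v) || e v w.
Proof. by rewrite inE. Qed.

Lemma closed_nbhd_refl (T : finType) (e : rel T) (v : T) :
  v \in closed_nbhd e v.
Proof. by rewrite in_closed_nbhd eqxx. Qed.

Lemma closed_nbhd_sym (T : finType) (e : rel T) (v w : T) :
  symmetric e -> (w \in closed_nbhd e v) = (v \in closed_nbhd e w).
Proof. by move=> e_sym; rewrite !in_closed_nbhd eq_sym e_sym. Qed.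

Definition universal_in (T : finType) (e : rel T) (B : {set T}) : {set T} :=
  [set u in B | B \subset closed_nbhd e u].

Lemma induced_P4_or_C4 (T : finType) (e : rel T) (c v a b : T) :
  simple_graph e -> c != a -> v != b ->
  e c v -> e v a -> e a b -> ~~ e c a -> ~~ e v b ->
  ~ trivially_perfect e.
Proof.
move=> [e_sym e_irr] ca vb cv va ab nca nvb [noP4 noC4].
have neq x y : e x y -> x != y.
  by apply: contraTneq => ->; rewrite e_irr.
have cb : c != b by apply: contraNneq nca => ->; rewrite e_sym.
pose f (i : 'I_4) := tnth [tuple c; v; a; b] i.
have f_inj : injective f.
  have /tuple_uniqP : uniq [tuple c; v; a; b] => //.
  by rewrite /= !inE !negb_or ca cb vb !neq.
have ebc x : e b c = x -> forall i j : 'I_4,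
    e (f i) (f j) = [|| P4 i j, (i == 3 :> nat) && (j == 0 :> nat) && x
                        | (i == 0 :> nat) && (j == 3 :> nat) && x].
  move=> bc.
  have E := (e_irr, cv, etrans (e_sym v c) cv, va, etrans (e_sym a v) va,
    ab, etrans (e_sym b a) ab, bc, etrans (e_sym c b) bc, negbTE nca,
    etrans (e_sym a c) (negbTE nca), negbTE nvb,
    etrans (e_sym b v) (negbTE nvb)).
  by case=> [[|[|[|[|//]]]] ?]; case=> [[|[|[|[|//]]]] ?];
    rewrite /f !(tnth_nth c) /P4 /= E ?orbF.
case bc: (e b c).
  apply: noC4; exists f; split=> // i j; rewrite (ebc _ bc).
  by move: i j; case=> [[|[|[|[|//]]]] ?]; case=> [[|[|[|[|//]]]] ?].
by apply: noP4; exists f; split=> // i j; rewrite (ebc _ bc) !andbF !orbF.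
Qed.

(* A vertex of [B] with the largest closed neighbourhood [N] inside [B] is
   universal unless [N] is a union of connected components of [B]: an edge
   leaving [N] at [a] would force some vertex of [N] to miss [a]. *)
Lemma universal_or_split (T : finType) (e : rel T) (B : {set T}) :
  simple_graph e -> trivially_perfect e -> B != set0 ->
  universal_in e B != set0 \/
  exists C : {set T}, [/\ C \proper B, C != set0
    & {in C & B :\: C, forall a b, ~~ e a b}].
Proof.
move=> hG hTP /set0Pn[v0 v0B]; have [e_sym _] := hG.
pose N v := closed_nbhd e v :&: B.
have [v vB vmax] := @arg_maxnP _ v0 [in B] (fun v => #|N v|) v0B.
have [BN|nBN] := boolP (B \subset closed_nbhd e v).
  by left; apply/set0Pn; exists v; rewrite inE vB.
right; exists (N v); split.
- rewrite properE subsetIr /=; apply: contra nBN => /subset_trans; apply.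
  exact: subsetIl.
- by apply/set0Pn; exists v; rewrite inE closed_nbhd_refl.
move=> a b; rewrite inE => /andP[aNv aB] /setDP[bB].
rewrite inE bB andbT => bNv; apply/negP => ab.
have va : e v a.
  move: aNv; rewrite in_closed_nbhd => /predU1P[av|//].
  by move: bNv; rewrite in_closed_nbhd -av ab orbT.
have : ~~ (N v \subset N a).
  apply/negP => sub; have /= := vmax a aB; rewrite leqNgt => /negP[].
  apply: proper_card; rewrite properE sub /=; apply/subsetPn; exists b.
    by rewrite inE in_closed_nbhd ab orbT bB.
  by rewrite inE (negbTE bNv).
case/subsetPn=> c; rewrite !inE => /andP[cv cB].
rewrite cB andbT negb_or => /andP[ca nac].
move: bNv; rewrite in_closed_nbhd negb_or => /andP[bv nvb].
apply: (@induced_P4_or_C4 _ e c v a b) => //; first by rewrite eq_sym.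
  by case/predU1P: cv => [cv|]; [rewrite cv e_sym va in nac | rewrite e_sym].
by rewrite e_sym.
Qed.

Definition twin_closed (T : finType) (e : rel T) (B : {set T}) : Prop :=
  forall u a, true_twins e u a -> u \in B -> a \in B.

Lemma twin_closedD (T : finType) (e : rel T) (B C : {set T}) :
  twin_closed e B -> twin_closed e C -> twin_closed e (B :\: C).
Proof.
move=> hB hC u a ua; rewrite !inE => /andP[uC uB].
by rewrite (hB _ _ ua uB) andbT; apply: contra uC; apply: hC.
Qed.

Lemma twin_closed_universal (T : finType) (e : rel T) (B : {set T}) :
  twin_closed e B -> twin_closed e (universal_in e B).
Proof.
by move=> hB u a ua; rewrite !inE => /andP[/(hB _ _ ua) -> ]; rewrite -ua.
Qed.

Lemma twin_closed_component (T : finType) (e : rel T) (B C : {set T}) :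
  twin_closed e B -> C \subset B ->
  {in C & B :\: C, forall a b, ~~ e a b} -> twin_closed e C.
Proof.
move=> hB CB sep u a ua uC; apply: contraT => aC.
have aB : a \in B by apply: hB ua _; apply: (subsetP CB).
have := closed_nbhd_refl e a; rewrite -ua in_closed_nbhd.
case/predU1P=> [au|]; first by rewrite au uC in aC.
by rewrite (negbTE (sep _ _ uC _)) // inE aC.
Qed.

(* The possible values of the factor [F] with [\sum_(v in B) x v = F * c]; the
   middle range is attained when [B] has a universal vertex, the last one when
   [B] is disconnected. *)
Definition response_range (R : realFieldType) (T : finType) (B : {set T})
    (F : R) : Prop :=
  [\/ B = set0 /\ F = 0, 3 / 4 <= F < 1 | 3 / 2 <= F].

Definition local_system (R : realFieldType) (T : finType) (e : rel T)
    (B : {set T}) (x : T -> R) (c : R) : Prop :=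
  {in B, forall v, x v + \sum_(w in closed_nbhd e v :&: B) x w = c}.

Definition local_response (R : realFieldType) (T : finType) (e : rel T)
    (B : {set T}) (F : R) : Prop :=
  forall (x : T -> R) (c : R), local_system e B x c ->
    \sum_(v in B) x v = F * c /\ (c = 0 -> {in B, forall v, x v = 0}).

Lemma response_range_ge (R : realFieldType) (T : finType) (B : {set T})
    (F : R) :
  B != set0 -> response_range B F -> 3 / 4 <= F.
Proof. by move=> B0 [[Be]|/andP[]|]; [rewrite Be eqxx in B0 | lra | lra]. Qed.

(* With [G = 1 - F], and [g] its value after the universal vertices are added,
   [1/g = w + 1/G]; the bound [g <= 1/4] reproduces itself when [w >= 6]
   because two components give [G <= -1/2]. *)
Lemma response_range_universal (R : realFieldType) (T : finType)
    (B : {set T}) (F w : R) :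
  6 <= w -> response_range B F ->
  1 + w * (1 - F) != 0 /\
  3 / 4 <= 1 - (1 - F) / (1 + w * (1 - F)) < 1.
Proof.
move=> w6 hF.
have [G0|G0] : 0 < 1 - F \/ 1 - F <= - (1 / 2).
- by case: hF => [[_ ->]|/andP[]|]; [left; lra | left; lra | right; lra].
- have d0 : 0 < 1 + w * (1 - F) by nra.
  split; first exact: lt0r_neq0.
  have q0 : 0 < (1 - F) / (1 + w * (1 - F)) by rewrite divr_gt0.
  have : (1 - F) / (1 + w * (1 - F)) <= 1 / 4 by rewrite ler_pdivrMr //; nra.
  by move: q0; lra.
have d0 : 1 + w * (1 - F) < 0 by nra.
split; first exact: ltr0_neq0.
have q0 : 0 < (1 - F) / (1 + w * (1 - F)).
  by rewrite -mulrNN -invrN divr_gt0 // oppr_gt0 //; lra.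
have : (1 - F) / (1 + w * (1 - F)) <= 1 / 4 by rewrite ler_ndivrMr //; nra.
by move: q0; lra.
Qed.

Lemma local_response_split (R : realFieldType) (T : finType) (e : rel T)
    (B C : {set T}) (F1 F2 : R) :
  symmetric e -> C \subset B -> {in C & B :\: C, forall a b, ~~ e a b} ->
  local_response e C F1 -> local_response e (B :\: C) F2 ->
  local_response e B (F1 + F2).
Proof.
move=> e_sym CB sep r1 r2 x c hx.
have sC : local_system e C x c.
  move=> v vC; rewrite -[RHS](hx v (subsetP CB v vC)); congr (_ + _).
  apply: eq_bigl => w; rewrite !inE.
  case wB: (w \in B); last first.
    by apply/andP/andP => -[] // _ /(subsetP CB); rewrite wB.
  rewrite andbT; case wC: (w \in C); rewrite ?andbT // andbF.
  have wD : w \in B :\: C by rewrite inE wC.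
  rewrite (negbTE (sep _ _ vC wD)) orbF; apply/esym/negbTE.
  by apply: contraFneq wC => ->.
have sD : local_system e (B :\: C) x c.
  move=> v vD; have [vB vC] := setDP vD.
  rewrite -[RHS](hx v vB); congr (_ + _).
  apply: eq_bigl => w; rewrite !inE.
  case wB: (w \in B); rewrite ?andbF // !andbT.
  case wC: (w \in C); rewrite ?andbT // andbF.
  rewrite e_sym (negbTE (sep _ _ wC vD)) orbF; apply/esym/negbTE.
  by apply: contraNneq vC => <-.
have [s1 z1] := r1 _ _ sC; have [s2 z2] := r2 _ _ sD; split.
  rewrite (big_setID C) /=.
  by rewrite (setIidPr CB) s1 s2 mulrDl.
move=> c0 v vB; case vC: (v \in C); first exact: z1.
by apply: z2 => //; rewrite inE vC.
Qed.

Lemma local_response_universal (R : realFieldType) (T : finType) (e : rel T)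
    (B : {set T}) (F : R) (w := #|universal_in e B|%:R) :
  symmetric e -> 1 + w * (1 - F) != 0 ->
  local_response e (B :\: universal_in e B) F ->
  local_response e B (1 - (1 - F) / (1 + w * (1 - F))).
Proof.
set U := universal_in e B in w *; move=> e_sym d0 rF x c hx.
have UB : U \subset B by apply/subsetP => u; rewrite inE => /andP[].
pose s := \sum_(v in B) x v.
have xU u : u \in U -> x u = c - s.
  rewrite inE => /andP[uB /setIidPr uN].
  by rewrite -(hx u uB) uN /s addrK.
have sumU : \sum_(u in U) x u = w * (c - s).
  by rewrite (eq_bigr _ xU) sumr_const -mulr_natl.
have sD : local_system e (B :\: U) x (c - w * (c - s)).
  move=> v vD; have [vB vU] := setDP vD.
  rewrite -[X in _ = X - _](hx v vB) [in RHS](big_setID U) /=.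
  have -> : closed_nbhd e v :&: B :&: U = U.
    apply/setIidPr/subsetP => u uU; rewrite inE (subsetP UB u uU) andbT.
    rewrite closed_nbhd_sym //; move: uU; rewrite inE => /andP[_ /subsetP].
    exact.
  by rewrite sumU -setIDA; ring.
have [sF zF] := rF _ _ sD.
have sE : s = w * (c - s) + F * (c - w * (c - s)).
  by rewrite {1}/s (big_setID U) /= (setIidPr UB) sumU sF.
have tE : c - s = (1 - F) / (1 + w * (1 - F)) * c.
  apply: (mulIf d0); rewrite mulrAC divfK //.
  have : (s - (w * (c - s) + F * (c - w * (c - s)))) = 0 by rewrite -sE subrr.
  by move=> h; apply/eqP; rewrite -subr_eq0 -oppr_eq0 -h; apply/eqP; ring.
split.
  by rewrite -/s mulrBl mul1r -tE; ring.
move=> c0 v vB; have t0 : c - s = 0 by rewrite tE c0 mulr0.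
case vU: (v \in U); first by rewrite xU.
by apply: zF; rewrite ?t0 ?c0 ?mulr0 ?subr0 // inE vU.
Qed.

Lemma card_universal_in (T : finType) (e : rel T) (B : {set T}) (m : nat) :
  (forall u, m <= #|[set a | closed_nbhd e a == closed_nbhd e u]|)%N ->
  twin_closed e B -> universal_in e B != set0 ->
  (m <= #|universal_in e B|)%N.
Proof.
move=> hm /twin_closed_universal hU /set0Pn[u uU].
apply: leq_trans (hm u) (subset_leq_card _); apply/subsetP => a.
by rewrite inE => /eqP au; apply: hU uU.
Qed.

Lemma exists_local_response (R : realFieldType) (T : finType) (e : rel T)
    (B : {set T}) :
  simple_graph e -> trivially_perfect e ->
  (forall u, 6 <= #|[set a | closed_nbhd e a == closed_nbhd e u]|)%N ->
  twin_closed e B ->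
  exists2 F : R, response_range B F & local_response e B F.
Proof.
move=> hG hTP h6; have [e_sym _] := hG.
have [n] := ubnP #|B|; elim: n B => // n IHn B ltB hB.
have [->|B0] := eqVneq B set0.
  exists 0; first by constructor 1.
  by move=> x c _; rewrite big_set0 mul0r; split=> // _ v; rewrite inE.
have [U0|[C [CB C0 sep]]] := universal_or_split hG hTP B0.
- have UB : universal_in e B \subset B.
    by apply/subsetP => u; rewrite inE => /andP[].
  have ltD : (#|B :\: universal_in e B| < n)%N.
    rewrite -ltnS; apply: leq_trans ltB; rewrite ltnS; apply: proper_card.
    rewrite properE subsetDl /=; case/set0Pn: U0 => u uU.
    apply/subsetPn; exists u; first exact: (subsetP UB).
    by rewrite inE uU.
  have [F rF lF] := IHn _ ltD (twin_closedD hB (twin_closed_universal hB)).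
  have w6 : 6 <= #|universal_in e B|%:R :> R.
    by rewrite ler_nat card_universal_in.
  have [d0 rg] := response_range_universal w6 rF.
  by exists (1 - (1 - F) / (1 + #|universal_in e B|%:R * (1 - F)));
    [constructor 2 | apply: local_response_universal].
have sCB := proper_sub CB.
have hC := twin_closed_component hB sCB sep.
have ltC : (#|C| < n)%N by apply: leq_trans (proper_card CB) _.
have ltD : (#|B :\: C| < n)%N.
  rewrite -ltnS; apply: leq_trans ltB; rewrite ltnS cardsDS //.
  by rewrite ltn_subrL !card_gt0 C0.
have D0 : B :\: C != set0 by rewrite setD_eq0; case/andP: CB.
have [F1 r1 l1] := IHn _ ltC hC.
have [F2 r2 l2] := IHn _ ltD (twin_closedD hB hC).
exists (F1 + F2); last exact: local_response_split sep l1 l2.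
constructor 3; have := response_range_ge C0 r1.
by have := response_range_ge D0 r2; lra.
Qed.

Lemma connected_universal (T : finType) (e : rel T) (x : T) :
  simple_graph e -> connected_graph e -> trivially_perfect e ->
  exists u, forall v, v \in closed_nbhd e u.
Proof.
move=> hG hconn hTP; have [e_sym _] := hG.
have T0 : [set: T] != set0 by apply/set0Pn; exists x.
have [/set0Pn[u]|[C [CT /set0Pn[a aC] sep]]] := universal_or_split hG hTP T0.
  by rewrite inE => /andP[_ /subsetP uN]; exists u => v; apply: uN; rewrite inE.
have [_ [b _ bC]] := properP CT.
have clC : closed e (mem C).
  apply: (intro_closed (sym_connect_sym e_sym)) => y z yz yC.
  by apply: contraT => zC; have := sep y z yC; rewrite !inE zC yz => /(_ isT).
by have := closed_connect clC (hconn a b); rewrite /= aC (negbTE bC).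
Qed.

Lemma gdist_universal (T : finType) (e : rel T) (u x y : T) :
  simple_graph e -> (2 < #|T|)%N -> (forall v, v \in closed_nbhd e u) ->
  gdist e x y = if x == y then 0%N else if e x y then 1%N else 2%N.
Proof.
move=> [e_sym e_irr] T2 hu; rewrite /gdist.
have p0 : has_path e x y 0 = (x == y).
  by apply/existsP/eqP => [[p]|->];
    [rewrite tuple0 /= => /eqP | exists [tuple]; rewrite /= eqxx].
have p1 : has_path e x y 1 = e x y.
  apply/existsP/idP => [[p]|xy].
    by case/tupleP: p => z p; rewrite tuple0 /= => /and3P[/andP[xz _] _ /eqP <-].
  exists [tuple y]; rewrite /= xy eqxx inE !andbT.
  by apply: contraTneq xy => ->; rewrite e_irr.
have p2 : x != y -> ~~ e x y -> has_path e x y 2.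
  move=> xy nxy; apply/existsP; exists [tuple u; y].
  have := hu x; have := hu y; rewrite !in_closed_nbhd.
  case/predU1P => [yu|uy]; case/predU1P => [xu|ux].
  - by rewrite xu yu eqxx in xy.
  - by rewrite e_sym yu ux in nxy.
  - by rewrite xu uy in nxy.
  rewrite /= e_sym ux uy eqxx !inE negb_or xy !andbT /=.
  by apply/andP; split; [apply: contraTneq ux | apply: contraTneq uy] => ->;
    rewrite e_irr.
case: #|T| T2 => [|[|[|n]]] //= _; rewrite p0 p1.
case: eqVneq => // xy; case: ifP => // /negbT nxy.
by rewrite p2.
Qed.

Theorem theorem10 (R : realFieldType) (T : finType) (e : rel T)
    (hG : simple_graph e) (hconn : connected_graph e)
    (hTP : trivially_perfect e)
    (W : {set {set T}}) (hW : true_twin_partition e W)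
    (hcard : forall A : {set T}, A \in W -> (6 <= #|A|)%N) :
  distance_matrix R e \in unitmx /\ nullity (distance_matrix R e) = 0%N.
Proof.
suff D_unit : distance_matrix R e \in unitmx.
  split=> //; apply/eqP; rewrite /nullity mxrank_eq0 kermx_eq0 row_free_unit.
  by rewrite unitmx_tr.
have [[/and3P[/eqP covW _ _] twW] [e_sym e_irr]] := (hW, hG).
have h6 u : (6 <= #|[set a | closed_nbhd e a == closed_nbhd e u]|)%N.
  have : u \in cover W by rewrite covW inE.
  case/bigcupP=> A AW uA; apply: leq_trans (hcard A AW) (subset_leq_card _).
  by apply/subsetP => a aA; rewrite inE; apply/eqP; apply: (twW A).
have [F rF lF] : exists2 F : R, response_range [set: T] F
    & local_response e [set: T] F.
  by apply: exists_local_response => // u a _; rewrite !inE.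
rewrite -row_free_unit -kermx_eq0; apply/rowV0P => v /sub_kermxP vD.
pose x t := v 0 (enum_rank t); pose s := \sum_(t in [set: T]) x t.
have sys : local_system e [set: T] x (2 * s).
  move=> t _; have [u hu] := connected_universal t hG hconn hTP.
  have T2 : (2 < #|T|)%N by rewrite (leq_trans _ (leq_trans (h6 t) (max_card _))).
  have := congr1 (fun M : 'rV_#|T| => M 0 (enum_rank t)) vD; rewrite !mxE.
  rewrite (reindex _ (onW_bij _ (@enum_rank_bij T))) /= => sum0.
  pose N := closed_nbhd e t :&: [set: T].
  have : \sum_a (2 * x a - (if a == t then x a else 0)
                  - (if a \in N then x a else 0)) = 0.
    rewrite -[RHS]sum0; apply: eq_bigr => a _; rewrite mxE !enum_rankK.
    rewrite (gdist_universal _ _ hG T2 hu) -/(x a) !inE andbT (e_sym a t).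
    by case: (a == t); case: (e t a) => /=; ring.
  rewrite !sumrB -mulr_sumr -!big_mkcond /= big_pred1_eq.
  have -> : \sum_a x a = s by apply: eq_bigl => a; rewrite inE.
  rewrite -/N; move: (\sum_(a in N) x a) => r; rewrite /x; lra.
have [sF zF] := lF _ _ sys.
apply/rowP => i; rewrite mxE.
have -> : v 0 i = x (enum_val i) by rewrite /x enum_valK.
apply: zF; last by rewrite inE.
have F34 : 3 / 4 <= F.
  by apply: response_range_ge rF; apply/set0Pn; exists (enum_val i); rewrite inE.
have d0 : 2 * F - 1 != 0 by apply: lt0r_neq0; move: F34; clear; lra.
have /eqP : (2 * F - 1) * s = 0 by rewrite mulrBl mul1r {2}/s sF; ring.
by rewrite mulf_eq0 (negbTE d0) => /eqP->; rewrite mulr0.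
Qed.
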